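(* Let $R$ be a commutative ring with unity and let $\Gamma$ be a (totally) ordered abelian group. Let $\Gamma'$ be any submonoid of $\Gamma_\infty$ and let $\mathfrak A$ be a topology on $\Gamma'$ such that: (P1) the addition $+:\Gamma'\times\Gamma'\to\Gamma'$ is continuous (with the product topology on $\Gamma'\times\Gamma'$), and (P2) for every $\gamma,\gamma'\in\Gamma'$ with $\gamma<\gamma'$ there exist open sets $U,U'\in\mathfrak A$ such that $\gamma\in U$, $\gamma'\in U'$ and $U<U'$ (i.e. $u<u'$ for every $u\in U$ and $u'\in U'$). Then the set $\mathcal W_{\Gamma'}$ of all valuations of $R$ taking values in $\Gamma'$ is closed in $(\Gamma')^R$ with respect to the product topology.
   Context: $\Gamma_\infty=\Gamma\cup\{\infty\}$, where $\infty\notin\Gamma$; addition and order are extended as usual: $\gamma+\infty=\infty+\gamma=\infty$ for all $\gamma\in\Gamma_\infty$ and $\gamma<\infty$ for all $\gamma\in\Gamma$. A valuation on $R$ taking values in $\Gamma_\infty$ is a map $\nu:R\to\Gamma_\infty$ such that (V1) $\nu(ab)=\nu(a)+\nu(b)$ for all $a,b\in R$; (V2) $\nu(a+b)\ge\min\{\nu(a),\nu(b)\}$ for all $a,b\in R$; (V3) $\nu(1)=0$ and $\nu(0)=\infty$. A valuation takes values in $\Gamma'$ if $\nu(R)\subseteq\Gamma'$. $(\Gamma')^R$ denotes the set of all functions $R\to\Gamma'$, with the product topology induced by $\mathfrak A$; $\mathcal W_{\Gamma'}$ is regarded as a subset of it. *)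

(* Defs.v *)
From HB Require Import structures.
From mathcomp Require Import all_boot all_order all_algebra.
From mathcomp Require Import all_classical all_analysis.

Set Implicit Arguments.
Unset Strict Implicit.
Unset Printing Implicit Defensive.

Import Order.TTheory GRing.Theory Num.Theory.
Local Open Scope classical_set_scope.
Local Open Scope ring_scope.

(* [porderZmodType] carries no compatibility between the order and the
   addition. Totality is a field of the mixin, rather than inherited from
   [Order.Total], because the library lacks the joins of the additive and the
   total order hierarchies below [realDomainType]. *)
HB.mixin Record POrderedZmodule_isTotallyOrdered G of Num.POrderedZmodule G := {
  oag_le_total : total (<=%R : rel G);
  oag_lerD2l : forall z x y : G, x <= y -> z + x <= z + y
}.

#[short(type="orderedAbelianGroupType")]
HB.structure Definition OrderedAbelianGroup :=
  { G of Num.POrderedZmodule G & POrderedZmodule_isTotallyOrdered G }.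

Definition with_infty (G : Type) : Type := option G.

Notation infty := (None : with_infty _).
Notation finite x := (Some x : with_infty _).

Section WithInfty.
Variable G : orderedAbelianGroupType.
Local Notation Goo := (with_infty G).
Implicit Types a b c : Goo.

HB.instance Definition _ := Choice.on Goo.

Definition add_infty a b : Goo :=
  match a, b with
  | Some x, Some y => Some (x + y)
  | _, _ => None
  end.

Definition le_infty a b : bool :=
  match a, b with
  | Some x, Some y => x <= y
  | _, None => true
  | None, Some _ => false
  end.

Definition lt_infty a b : bool :=
  match a, b with
  | Some x, Some y => x < y
  | Some _, None => true
  | None, _ => false
  end.

Fact add_inftyA : associative add_infty.
Proof. by move=> [x|] [y|] [z|] //=; rewrite addrA. Qed.

Fact add_inftyC : commutative add_infty.
Proof. by move=> [x|] [y|] //=; rewrite addrC. Qed.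

Fact add_infty0 : left_id (Some 0) add_infty.
Proof. by move=> [x|] //=; rewrite add0r. Qed.

HB.instance Definition _ :=
  GRing.isNmodule.Build Goo add_inftyA add_inftyC add_infty0.

Fact lt_infty_def a b : lt_infty a b = (b != a) && le_infty a b.
Proof. by case: a b => [x|] [y|] //=; rewrite lt_def. Qed.

Fact le_infty_refl : reflexive le_infty.
Proof. by case=> //= x. Qed.

Fact le_infty_anti : antisymmetric le_infty.
Proof. by move=> [x|] [y|] //= /le_anti ->. Qed.

Fact le_infty_trans : transitive le_infty.
Proof. by move=> [x|] [y|] [z|] //=; exact: le_trans. Qed.

Fact le_infty_total : total le_infty.
Proof. by move=> [x|] [y|] //=; exact: oag_le_total. Qed.

HB.instance Definition _ := Order.isPOrder.Build ring_display Goo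
  lt_infty_def le_infty_refl le_infty_anti le_infty_trans.

HB.instance Definition _ :=
  Order.POrder_isTotal.Build ring_display Goo le_infty_total.

End WithInfty.

(* An [addrClosed] predicate contains 0 and is stable under addition, that is,
   it is a submonoid. Being boolean is no restriction: classically every set
   is decided by a boolean predicate. *)
Section SubmonoidType.
Variables (M : nmodType) (S : addrClosed M).

Record submonoid_type : Type :=
  Submonoid { submonoid_val : M; submonoid_valP : submonoid_val \in S }.

HB.instance Definition _ := [isSub for submonoid_val].
HB.instance Definition _ := [Choice of submonoid_type by <:].
HB.instance Definition _ :=
  GRing.SubChoice_isSubNmodule.Build M _ submonoid_type (rpred0D S).

End SubmonoidType.

(* [Topological T] is the type of all topologies on the type [T]. *)
Definition space_of (T : Type) (A : Topological T) : topologicalType :=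
  Topological.Pack A.

Section Valuations.
Variables (R : comPzRingType) (G : orderedAbelianGroupType).

Record is_valuation (nu : R -> with_infty G) : Prop := IsValuation {
  valuationM : forall a b, nu (a * b) = nu a + nu b;
  valuationD : forall a b, Num.min (nu a) (nu b) <= nu (a + b);
  valuation1 : nu 1 = finite 0;
  valuation0 : nu 0 = infty
}.

Definition valuations (S : addrClosed (with_infty G)) :
    set (R -> submonoid_type S) :=
  [set f | is_valuation (fun a => val (f a))].

End Valuations.

Arguments valuations R {G} S.

(* Main.v *)
Require Import Defs.
From HB Require Import structures.
From mathcomp Require Import all_boot all_order all_algebra.
From mathcomp Require Import all_classical all_analysis.

Set Implicit Arguments.
Unset Strict Implicit.
Unset Printing Implicit Defensive.

Import Order.TTheory GRing.Theory Num.Theory.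
Local Open Scope classical_set_scope.
Local Open Scope ring_scope.

(** Being a valuation is a (possibly infinite) conjunction of conditions, each
    an equality or a weak inequality involving finitely many values of the
    function [f]; such a condition is closed as soon as both sides depend
    continuously on [f].  Hypothesis [P2] says that strict inequality is an
    open relation on [Gamma']; since the order is total, weak inequality is
    therefore closed ([closed_le_comp]), and so is equality, by antisymmetry
    ([closed_eq_comp]).  Evaluations are continuous for the product topology,
    and sums of evaluations are continuous by [P1].  The ultrametric inequality
    becomes a union of two closed conditions, because in a total order
    [min x y <= z] means [x <= z] or [y <= z].

    The axiom [f 0 = infty] needs care, since [infty] may lie outside
    [Gamma'].  In that case there is no valuation with values in [Gamma'], and
    the empty set is closed; otherwise any valuation [g] yields the element
    [g 0] of [Gamma'] representing [infty], and the axiom reads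
    [f 0 = g 0]. *)

Section OrderSeparated.
Variables (d : Order.disp_t) (L : orderType d) (T : topologicalType).
Variable v : T -> L.
Hypothesis separated_lt : forall x y : T, (v x < v y)%O ->
  exists U V : set T,
    [/\ open U, open V, U x, V y & forall x' y', U x' -> V y' -> (v x' < v y')%O].

(** By totality the complement is the set where [v (g x) < v (f x)], and the
    separating sets pull back to a neighbourhood on which this persists. *)
Lemma closed_le_comp (X : topologicalType) (f g : X -> T) :
  continuous f -> continuous g -> closed [set x | (v (f x) <= v (g x))%O].
Proof.
move=> cf cg; rewrite -openC openE => x /= /negP; rewrite -ltNge => gf.
have [U [V [oU oV Ug Vf UV]]] := separated_lt gf.
have nU : nbhs x (g @^-1` U) by apply: cg; exact: open_nbhs_nbhs.
have nV : nbhs x (f @^-1` V) by apply: cf; exact: open_nbhs_nbhs.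
apply: filterS (filterI nU nV) => y [Uy Vy] /=.
by apply/negP; rewrite -ltNge; exact: UV.
Qed.

Lemma closed_eq_comp (X : topologicalType) (f g : X -> T) :
  injective v -> continuous f -> continuous g -> closed [set x | f x = g x].
Proof.
move=> vinj cf cg.
rewrite (_ : [set x | _] = [set x | (v (f x) <= v (g x))%O] `&`
                           [set x | (v (g x) <= v (f x))%O]).
  by apply: closedI; exact: closed_le_comp.
apply/seteqP; split => x /= [] => [->|fg gf]; first by rewrite lexx.
by apply: vinj; apply/eqP; rewrite eq_le fg gf.
Qed.

End OrderSeparated.

Theorem theorem1p1 (R : comPzRingType) (Gamma : orderedAbelianGroupType)
    (Gamma' : addrClosed (with_infty Gamma))
    (A : Topological (submonoid_type Gamma'))
    (P1 : continuous
       ((fun p => p.1 + p.2 : submonoid_type Gamma')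
         : space_of A * space_of A -> space_of A))
    (P2 : forall g g' : submonoid_type Gamma', val g < val g' ->
       exists U U' : set (space_of A),
         [/\ open U, open U', U g, U' g' &
             forall u u' : submonoid_type Gamma',
               U u -> U' u' -> val u < val u']) :
  closed (valuations R Gamma' : set {ptws R -> space_of A}).
Proof.
pose F : topologicalType := {ptws R -> space_of A}.
pose v (x : space_of A) : with_infty Gamma := val (x : submonoid_type Gamma').
have vinj : injective v by exact: val_inj.
have eval_cont (a : R) : continuous ((fun f => f a) : F -> space_of A).
  exact: proj_continuous.
have evalD_cont (a b : R) :
    continuous ((fun f => (f a : submonoid_type Gamma') + f b)
      : F -> space_of A).
  move=> f; apply: (@continuous_comp F (space_of A * space_of A)%type
    (space_of A) (fun f => (f a, f b))
    (fun p => (p.1 : submonoid_type Gamma') + p.2)).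
    exact: (cvg_pair (eval_cont a f) (eval_cont b f)).
  exact: P1.
have closed_eval_le (a b : R) : closed [set f : F | v (f a) <= v (f b)].
  exact: (closed_le_comp (v := v) P2 (eval_cont a) (eval_cont b)).
have closed_eval_eq (a : R) (y : space_of A) : closed [set f : F | f a = y].
  exact: (closed_eq_comp (v := v) P2 vinj (eval_cont a)
    (@cst_continuous F (space_of A) y)).
have [[g [_ _ _ g0]]|noval] := pselect (exists g, valuations R Gamma' g);
    last first.
  rewrite (_ : valuations R Gamma' = set0); first exact: closed0.
  by rewrite -subset0 => g valg; apply: noval; exists g.
pose multiplicative_at (p : R * R) : set F := [set f | f (p.1 * p.2) =
  (f p.1 : submonoid_type Gamma') + (f p.2 : submonoid_type Gamma')].
pose ultrametric_at (p : R * R) : set F :=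
  [set f | v (f p.1) <= v (f (p.1 + p.2))] `|`
  [set f | v (f p.2) <= v (f (p.1 + p.2))].
pose unit_to_0 : set F := [set f | f 1 = (0 : submonoid_type Gamma')].
pose zero_to_infty : set F := [set f | f 0 = g 0].
rewrite (_ : valuations R Gamma' =
  (\bigcap_p multiplicative_at p) `&` (\bigcap_p ultrametric_at p) `&`
  unit_to_0 `&` zero_to_infty); last first.
  apply/seteqP; split => [f [fM fD f1 f0]|f [[[fM fD] f1] f0]].
    split; [split; [split|]|].
    - by move=> [a b] _; apply: val_inj; rewrite fM.
    - move=> [a b] _; have := fD a b.
      by rewrite ge_min => /orP[]; [left|right].
    - exact: val_inj.
    - by apply: val_inj; rewrite f0 g0.
  split=> [a b|a b||].
  - by rewrite [f _](fM (a, b) I).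
  - by rewrite ge_min; apply/orP; case: (fD (a, b) I); [left|right].
  - by rewrite [f _]f1.
  - by rewrite [f _]f0.
apply: closedI; first apply: closedI; first apply: closedI.
- apply: closed_bigI => p _.
  exact: (closed_eq_comp (v := v) P2 vinj (eval_cont _) (evalD_cont _ _)).
- by apply: closed_bigI => p _; apply: closedU; exact: closed_eval_le.
- exact: closed_eval_eq.
- exact: closed_eval_eq.
Qed.
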